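(* Let $\theta_1<\theta_2$ be real numbers, let $\alpha\in(0,1]$, let $q>1$ and $p^{-1}+q^{-1}=1$, and let $f:[\theta_1,\theta_2]\to\mathbb{R}$ be differentiable on $(\theta_1,\theta_2)$ with $f\in H^1(\theta_1,\theta_2)$ and $f'\in L_1[\theta_1,\theta_2]$. If $|f'|^q$ is concave on $(\theta_1,\theta_2)$, then $$\Bigg|\frac{2(\theta_2-\theta_1)^{\alpha}+(1-\alpha)2^{\alpha+1}\Gamma(\alpha)}{(\theta_2-\theta_1)^{\alpha+1}}\left[f(\theta_1)+f(\theta_2)+2f\left(\tfrac{\theta_1+\theta_2}{2}\right)\right]$$ $$-\frac{2^{\alpha+1}B(\alpha)\Gamma(\alpha)}{(\theta_2-\theta_1)^{\alpha+1}}\left[\left({}^{AB}I^{\alpha}_{\frac{\theta_1+\theta_2}{2}}f\right)(\theta_1)+\left({}^{AB}_{\theta_1}I^{\alpha}f\right)\left(\tfrac{\theta_1+\theta_2}{2}\right)+\left({}^{AB}_{\frac{\theta_1+\theta_2}{2}}I^{\alpha}f\right)(\theta_2)+\left({}^{AB}I^{\alpha}_{\theta_2}f\right)\left(\tfrac{\theta_1+\theta_2}{2}\right)\right]\Bigg|$$ $$\le\frac{2}{(\alpha p+1)^{1/p}}\left[\left|f'\left(\frac{3\theta_1+\theta_2}{4}\right)\right|+\left|f'\left(\frac{3\theta_2+\theta_1}{4}\right)\right|\right].$$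
   Context: $\Gamma$ is the Gamma function and $B(\alpha)>0$ is the value at $\alpha$ of a normalization function $B$. $f\in H^1(\theta_1,\theta_2)$ means that $f$ is absolutely continuous on $[\theta_1,\theta_2]$ with $f'$ square integrable. The left and right Atangana-Baleanu fractional integrals of order $\alpha$ are, for $a<b$ in $[\theta_1,\theta_2]$, $$\left({}^{AB}_{a}I^{\alpha}f\right)(t)=\frac{1-\alpha}{B(\alpha)}f(t)+\frac{\alpha}{B(\alpha)\Gamma(\alpha)}\int_a^t f(y)(t-y)^{\alpha-1}\,dy\quad(t>a),$$ $$\left({}^{AB}I^{\alpha}_{b}f\right)(t)=\frac{1-\alpha}{B(\alpha)}f(t)+\frac{\alpha}{B(\alpha)\Gamma(\alpha)}\int_t^b f(y)(y-t)^{\alpha-1}\,dy\quad(t<b).$$ *)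

(* Defs.v *)
From HB Require Import structures.
From mathcomp Require Import all_boot all_order all_algebra.
From mathcomp Require Import all_classical all_reals all_analysis.

Set Implicit Arguments.
Unset Strict Implicit.
Unset Printing Implicit Defensive.

Import Order.TTheory GRing.Theory Num.Theory.
Import numFieldNormedType.Exports.

Local Open Scope classical_set_scope.
Local Open Scope ring_scope.

(* A function on [a, b] is represented by a total function R -> R whose values
   outside [a, b] are never used.  For this reason conditions on the derivative
   are imposed on the open interval: at the (negligible) endpoints the two-sided
   derivative f^`() would depend on the values of f outside [a, b]. *)

Definition Gamma (R : realType) (x : R) : R :=
  (\int[lebesgue_measure]_(t in `]0%R, +oo[) (t `^ (x - 1) * expR (- t)))%R.

Definition absolutely_continuous (R : realType) (a b : R) (f : R -> R) : Prop :=
  forall e : R, 0 < e -> exists2 d : R, 0 < d &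
    forall (n : nat) (u v : 'I_n -> R),
      (forall i, a <= u i /\ u i <= v i /\ v i <= b) ->
      trivIset setT (fun i => `]u i, v i[%classic) ->
      \sum_(i < n) (v i - u i) < d ->
      \sum_(i < n) `|f (v i) - f (u i)| < e.

Definition L1_on (R : realType) (a b : R) (g : R -> R) : Prop :=
  (@lebesgue_measure R).-integrable `]a, b[ (EFin \o g).

Definition L2_on (R : realType) (a b : R) (g : R -> R) : Prop :=
  measurable_fun `]a, b[ g /\
  (@lebesgue_measure R).-integrable `]a, b[ (EFin \o (fun x => g x ^+ 2)).

Definition H1 (R : realType) (a b : R) (f : R -> R) : Prop :=
  absolutely_continuous a b f /\ L2_on a b f^`()%classic.

Definition concave_on (R : realType) (D : set R) (g : R -> R) : Prop :=
  @convex_function R R^o D (fun x => - g x).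

Definition AB_left (R : realType) (B : R -> R) (a alpha : R) (f : R -> R)
    (t : R) : R :=
  (1 - alpha) / B alpha * f t +
  alpha / (B alpha * Gamma alpha) *
    (\int[lebesgue_measure]_(y in `[a, t]) (f y * (t - y) `^ (alpha - 1)))%R.

Definition AB_right (R : realType) (B : R -> R) (b alpha : R) (f : R -> R)
    (t : R) : R :=
  (1 - alpha) / B alpha * f t +
  alpha / (B alpha * Gamma alpha) *
    (\int[lebesgue_measure]_(y in `[t, b]) (f y * (y - t) `^ (alpha - 1)))%R.

(* Main.v *)
Require Import Defs.
From HB Require Import structures.
From mathcomp Require Import all_boot all_order all_algebra.
From mathcomp Require Import all_classical all_reals all_analysis.
From mathcomp Require Import measurable_realfun ring lra.

Set Implicit Arguments.
Unset Strict Implicit.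
Unset Printing Implicit Defensive.

Import Order.TTheory GRing.Theory Num.Theory.
Import numFieldNormedType.Exports.

Local Open Scope classical_set_scope.
Local Open Scope ring_scope.

(** Write [h = (theta2 - theta1) / 2] and [m] for the midpoint. After the
    terms with [1 - alpha] cancel, the left-hand side is [h ^ -(alpha + 1)] times
    the sum, over the two halves [a, b] = [theta1, m] and [m, theta2], of
      [(f a + f b) h^alpha
         - alpha * int_a^b f(y) ((y - a)^(alpha-1) + (b - y)^(alpha-1)) dy].
    Since [alpha * int_a^b (y - a)^(alpha-1) dy = h^alpha], and likewise for
    [b - y], this is
      [alpha * int_a^b (f b - f y) (y - a)^(alpha-1)
                     + (f a - f y) (b - y)^(alpha-1) dy],
    which only involves increments of [f].

    Increments are controlled by concavity. If [|f'|^q] is concave it has a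
    supergradient at the midpoint [c] of [a, b], and Young's inequality turns
    it into an affine majorant [|f' y| <= |f' c| + s (y - c)]
    ([concave_on_powR_supergradient]). Comparing [f] with a primitive of this
    majorant, a quadratic polynomial, bounds every increment of [f]
    ([norm_increment_le_quad]). Integrating against the two weights leaves
    power integrals. The two weights are mirror images of each other about [c],
    so the contributions of the slope [s] cancel, and each half is at most
    [2 |f' c| h^(alpha+1) / (alpha+1)] ([fractional_trapezoid_le]).

    The constant so obtained, [2 / (alpha+1)], is better than the stated one:
    [(alpha p + 1)^(1/p) <= alpha + 1] is Bernoulli's inequality
    ([powR_root_le]). That [Gamma alpha] cancels requires it to be nonzero
    ([Gamma_gt0]). *)

(** * Improper integrals of powers *)

(** The integrand may blow up at both ends: continuity and sign are only asked
    inside, and the value comes by monotone convergence from segments that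
    exhaust [a, b]. This covers [x ^ (beta - 1)] with [beta < 1] on either
    side. *)
Lemma ge0_improper_FTC2 (R : realType) (f F : R -> R) (a b : R) : a < b ->
  {in `]a, b[, continuous f} ->
  (forall x, x \in `]a, b[ -> 0 <= f x) ->
  {within `[a, b], continuous F} ->
  (forall x, x \in `]a, b[ -> is_derive x 1 F (f x)) ->
  (\int[lebesgue_measure]_(x in `[a, b]) (f x)%:E = (F b - F a)%:E)%E.
Proof.
move=> ab cf f0 cF dF.
have [cFoo cFa cFb] := (continuous_within_itvP F ab).1 cF.
(* The factor 1/3 keeps a + e n < b - e n even for n = 0. *)
pose e n : R := (b - a) / 3 * harmonic n.
have e0 n : 0 < e n by rewrite mulr_gt0// ?divr_gt0 ?subr_gt0// invr_gt0.
have e3 n : e n <= (b - a) / 3.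
  by rewrite ler_piMr ?divr_ge0 ?subr_ge0 ?(ltW ab)// invf_le1 // ler1n.
have ecvg : e @ \oo --> 0.
  by rewrite -(mulr0 ((b - a) / 3)); apply: cvgMr; exact: cvg_harmonic.
have enon m n : (m <= n)%N -> e n <= e m.
  move=> mn; rewrite ler_wpM2l ?divr_ge0 ?subr_ge0 ?(ltW ab)//.
  by rewrite lef_pV2 ?posrE// ler_nat ltnS.
clearbody e.
pose S n := `[a + e n, b - e n]%classic.
have Soo n : S n `<=` `]a, b[.
  move=> x; rewrite /S/= !in_itv/= => /andP[x1 x2].
  by have en := e0 n; apply/andP; split; lra.
have mf : measurable_fun `]a, b[ f.
  apply: open_continuous_measurable_fun; first exact: interval_open.
  exact/in_continuous_mksetP.
have -> : (\int[lebesgue_measure]_(x in `[a, b]) (f x)%:E =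
           \int[lebesgue_measure]_(x in `]a, b[) (f x)%:E)%E.
  by apply: integral_itv_bndoo; exact/measurable_EFinP.
have -> : `]a, b[%classic = \bigcup_n S n.
  apply/seteqP; split=> [x /=|x [n _]]; last exact: Soo.
  rewrite in_itv/= => /andP[ax xb].
  have m0 : 0 < Num.min (x - a) (b - x) by rewrite lt_min !subr_gt0 ax xb.
  have /filter_ex[n] : \forall n \near \oo, e n < Num.min (x - a) (b - x).
    exact: (cvgr_lt 0 ecvg).
  rewrite lt_min => /andP[n1 n2]; exists n => //.
  by rewrite /S/= in_itv/=; apply/andP; split; lra.
have intS n : (\int[lebesgue_measure]_(x in S n) (f x)%:E =
    (F (b - e n) - F (a + e n))%:E)%E.
  have abn : a + e n < b - e n by have := e3 n; lra.
  rewrite EFinB; apply: continuous_FTC2 => //.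
  - apply: continuous_in_subspaceT => x; rewrite inE => /Soo; exact: cf.
  - have sub : `[a + e n, b - e n] `<=` `[a, b].
      by apply: subset_trans (@Soo n) _; exact: subset_itv_oo_cc.
    have /(continuous_within_itvP _ abn)[_ c1 c2] := continuous_subspaceW sub cF.
    split => // x xin; have /dF [] // : x \in `]a, b[.
    exact: (@Soo n) (subset_itv_oo_cc xin).
  - move=> x xin; have /dF dFx : x \in `]a, b[.
      exact: (@Soo n) (subset_itv_oo_cc xin).
    by rewrite derive1E; exact: derive_val.
have lim1 : (fun n => \int[lebesgue_measure]_(x in S n) (f x)%:E)%E @ \oo -->
    (\int[lebesgue_measure]_(x in \bigcup_n S n) (f x)%:E)%E.
  apply: ge0_nondecreasing_set_cvg_integral => //.
  - move=> m n mn; apply/subsetPset; apply: subset_itv; rewrite bnd_simp.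
      by rewrite lerD2l enon.
    by rewrite lerD2l lerN2 enon.
  - by move=> n; exact: measurable_itv.
  - move=> n; apply/measurable_EFinP.
    exact: measurable_funS (measurable_itv _) (@Soo n) mf.
  - by move=> n x /Soo xab; rewrite lee_fin f0.
have lim2 : (fun n => \int[lebesgue_measure]_(x in S n) (f x)%:E)%E @ \oo -->
    (F b - F a)%:E.
  under eq_fun do rewrite intS.
  apply: cvg_EFin; first exact: nearW.
  apply: cvgB.
    apply: (cvg_at_leftP _ _ _).1 cFb _ _; split => [n|].
      by rewrite ltrBlDr ltrDl.
    by rewrite -[X in _ --> X]subr0; apply: cvgB => //; exact: cvg_cst.
  apply: (cvg_at_rightP _ _ _).1 cFa _ _; split => [n|].
    by rewrite ltrDl.
  by rewrite -[X in _ --> X]addr0; apply: cvgD => //; exact: cvg_cst.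
by rewrite -(cvg_lim _ lim1)// (cvg_lim _ lim2).
Qed.

Lemma is_derive_powR_subl (R : realType) (a x beta : R) : beta != 0 -> a < x ->
  is_derive x 1 (fun y => (y - a) `^ beta / beta) ((x - a) `^ (beta - 1)).
Proof.
move=> b0 ax; have xa : 0 < x - a by rewrite subr_gt0.
have d1 : is_derive x 1 (fun y => y - a : R) 1.
  by apply: is_derive_eq; rewrite oppr0 addr0.
have d2 := @is_derive1_comp _ (@powR R ^~ beta) (fun y => y - a) _ _ _
  (is_derive1_powR beta xa) d1.
have := is_deriveZ beta^-1 d2.
rewrite mulr1 /GRing.scale/= mulKf// => d3.
by rewrite (_ : (fun y => _) = beta^-1 \*: ((@powR R ^~ beta) \o (fun y => y - a)))//;
  apply/funext => y /=; rewrite mulrC.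
Qed.

Lemma is_derive_powR_subr (R : realType) (b x beta : R) : beta != 0 -> x < b ->
  is_derive x 1 (fun y => - ((b - y) `^ beta / beta)) ((b - x) `^ (beta - 1)).
Proof.
move=> b0 ax; have xa : 0 < b - x by rewrite subr_gt0.
have d1 : is_derive x 1 (fun y => b - y : R) (-1).
  by apply: is_derive_eq; rewrite add0r mul1r.
have d2 := @is_derive1_comp _ (@powR R ^~ beta) (fun y => b - y) _ _ _
  (is_derive1_powR beta xa) d1.
have := is_deriveZ (- beta^-1) d2.
rewrite mulrN1 /GRing.scale/= mulrNN mulKf// => d3.
by rewrite (_ : (fun y => _) = (- beta^-1) \*: ((@powR R ^~ beta) \o (fun y => b - y)))//;
  apply/funext => y /=; rewrite /GRing.scale/= mulNr mulrC.
Qed.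

Lemma integral_powR_subl (R : realType) (a b beta : R) : a < b -> 0 < beta ->
  (\int[lebesgue_measure]_(x in `[a, b]) ((x - a) `^ (beta - 1))%:E =
   ((b - a) `^ beta / beta)%:E)%E.
Proof.
move=> ab beta0; have bN0 : beta != 0 by rewrite gt_eqF.
pose F y := (y - a) `^ beta / beta.
have dF x : a < x -> is_derive x 1 F ((x - a) `^ (beta - 1)).
  exact: is_derive_powR_subl.
have cF x : a < x -> {for x, continuous F}.
  move=> /dF [dFx _]; apply: differentiable_continuous; exact/derivable1_diffP.
have Fa : F a = 0 by rewrite /F subrr powR0// mul0r.
rewrite -[X in _ = X%:E]/(F b) -[F b]subr0 -Fa.
apply: ge0_improper_FTC2 => //.
- move=> x; rewrite in_itv/= => /andP[ax _].
  have xa : 0 < x - a by rewrite subr_gt0.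
  have [dx _] := is_derive1_powR (beta - 1) xa.
  have dc : {for x - a, continuous (@powR R ^~ (beta - 1))}.
    by apply: differentiable_continuous; exact/derivable1_diffP.
  apply: (@continuous_comp _ _ _ (fun y => y - a) (@powR R ^~ (beta - 1))) => //.
  by apply: cvgB => //; exact: cvg_cst.
- by move=> x _; exact: powR_ge0.
- apply/(continuous_within_itvP _ ab); split.
  + by move=> x; rewrite in_itv/= => /andP[ax _]; exact: cF.
  + rewrite Fa; apply/cvg_at_rightP => u [ua uc].
    rewrite -(mul0r beta^-1); apply: cvgMl.
    apply: ((cvg_at_rightP _ 0 0).1 (powR_cvg0 beta0) (fun n => u n - a)).
    split => [n|]; first by rewrite subr_gt0.
    by rewrite -(subrr a); apply: cvgB => //; exact: cvg_cst.
  + by apply: cvg_at_left_filter; exact: cF.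
- by move=> x; rewrite in_itv/= => /andP[ax _]; exact: dF.
Qed.

Lemma integral_powR_subr (R : realType) (a b beta : R) : a < b -> 0 < beta ->
  (\int[lebesgue_measure]_(x in `[a, b]) ((b - x) `^ (beta - 1))%:E =
   ((b - a) `^ beta / beta)%:E)%E.
Proof.
move=> ab beta0; have bN0 : beta != 0 by rewrite gt_eqF.
pose F y := - ((b - y) `^ beta / beta).
have dF x : x < b -> is_derive x 1 F ((b - x) `^ (beta - 1)).
  exact: is_derive_powR_subr.
have cF x : x < b -> {for x, continuous F}.
  move=> /dF [dFx _]; apply: differentiable_continuous; exact/derivable1_diffP.
have Fb : F b = 0 by rewrite /F subrr powR0// mul0r oppr0.
rewrite -[X in _ = X%:E]opprK -[X in _ = (- X)%:E]/(F a) -[- F a]add0r -Fb.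
apply: ge0_improper_FTC2 => //.
- move=> x; rewrite in_itv/= => /andP[_ xb].
  have bx : 0 < b - x by rewrite subr_gt0.
  have [dx _] := is_derive1_powR (beta - 1) bx.
  have dc : {for b - x, continuous (@powR R ^~ (beta - 1))}.
    by apply: differentiable_continuous; exact/derivable1_diffP.
  apply: (@continuous_comp _ _ _ (fun y => b - y) (@powR R ^~ (beta - 1))) => //.
  by apply: cvgB => //; exact: cvg_cst.
- by move=> x _; exact: powR_ge0.
- apply/(continuous_within_itvP _ ab); split.
  + by move=> x; rewrite in_itv/= => /andP[_ xb]; exact: cF.
  + by apply: cvg_at_right_filter; exact: cF.
  + rewrite Fb; apply/cvg_at_leftP => u [ub uc].
    rewrite -oppr0 -(mul0r beta^-1); apply: cvgN; apply: cvgMl.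
    apply: ((cvg_at_rightP _ 0 0).1 (powR_cvg0 beta0) (fun n => b - u n)).
    split => [n|]; first by rewrite subr_gt0.
    by rewrite -(subrr b); apply: cvgB => //; exact: cvg_cst.
- by move=> x; rewrite in_itv/= => /andP[_ xb]; exact: dF.
Qed.

(** * Positivity of the Gamma function *)

Lemma integral_expRN (R : realType) :
  (\int[lebesgue_measure]_(x in `[0%R, +oo[) (expR (- x : R))%:E = 1%E :> \bar R)%E.
Proof.
have dE (x : R) : is_derive x 1 (fun y => - expR (- y)) (expR (- x)).
  by apply: is_derive_eq; rewrite /GRing.scale/= mulrN1 opprK.
have cE : continuous (fun y : R => expR (- y)).
  move=> x; apply: (@continuous_comp _ _ _ -%R expR); last exact: continuous_expR.
  exact: oppr_continuous.
rewrite (@ge0_continuous_FTC2y _ _ (fun y => - expR (- y)) _ 0).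
- by rewrite oppr0 expR0 EFinN sub0e oppeK.
- by move=> x _; exact: expR_ge0.
- exact: continuous_subspaceT.
- by rewrite -oppr0; apply: cvgN; exact: cvgr_expR.
- by move=> x _; have [] := dE x.
- by apply: cvg_at_right_filter; apply: cvgN; exact: cE.
- by move=> x _; rewrite derive1E; have [_ ->] := dE x.
Qed.

(** Positivity also includes convergence, because a divergent real-valued
    integral is 0 by convention. As [alpha <= 1], the integrand is below
    [t ^ (alpha - 1)] on (0, 1] and below [expR (- t)] beyond 1. *)
Lemma Gamma_gt0 (R : realType) (alpha : R) : 0 < alpha <= 1 -> 0 < Gamma alpha.
Proof.
move=> /andP[a0 a1].
pose k t : R := t `^ (alpha - 1) * expR (- t).
have mE : measurable_fun setT (fun t : R => expR (- t)).
  apply: continuous_measurable_fun => x.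
  apply: (@continuous_comp _ _ _ -%R expR); last exact: continuous_expR.
  exact: oppr_continuous.
have mP : measurable_fun setT (fun t : R => t `^ (alpha - 1)).
  exact: measurable_powR.
have mk D : measurable_fun D (EFin \o k).
  by apply/measurable_EFinP; apply: measurable_funTS; exact: measurable_funM.
have k0 t : (0 <= (k t)%:E)%E.
  by rewrite lee_fin mulr_ge0 ?powR_ge0 ?expR_ge0.
have I01 : (\int[lebesgue_measure]_(t in `]0%R, 1%R]) (t `^ (alpha - 1))%:E =
    (alpha^-1)%:E)%E.
  rewrite integral_itv_obnd_cbnd; last first.
    by apply/measurable_EFinP; apply: measurable_funTS.
  have := integral_powR_subl (ltr01 : 0 < 1 :> R) a0.
  rewrite subr0 powR1 mul1r => <-.
  by apply: eq_integral => x _; rewrite subr0.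
have Isplit : (\int[lebesgue_measure]_(t in `]0%R, +oo[) (k t)%:E =
    \int[lebesgue_measure]_(t in `]0%R, 1%R]) (k t)%:E +
    \int[lebesgue_measure]_(t in `]1%R, +oo[) (k t)%:E)%E.
  rewrite -ge0_integral_setU//=.
  - by rewrite -itv_bndbnd_setU ?bnd_simp.
  - exact: mk.
  - apply/disj_setPS => x []/=; rewrite !in_itv/= => /andP[_ x1].
    by rewrite andbT ltNge x1.
have I1y : (\int[lebesgue_measure]_(t in `]1%R, +oo[) (k t)%:E <= 1)%E.
  rewrite -(integral_expRN R).
  apply: (@le_trans _ _ (\int[lebesgue_measure]_(t in `]1%R, +oo[)
      (expR (- t))%:E)%E).
    apply: ge0_le_integral => //=.
    - exact: mk.
    - by apply/measurable_EFinP; exact: measurable_funTS.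
    - move=> t; rewrite in_itv/= andbT => t1; rewrite lee_fin ler_piMl ?expR_ge0//.
      by rewrite -[leRHS](powRr0 t) ler_powR ?(ltW t1)// subr_le0.
  apply: ge0_subset_integral => //=.
  - by apply/measurable_EFinP; exact: measurable_funTS.
  - by apply: subset_itvr; rewrite bnd_simp.
have I01u : (\int[lebesgue_measure]_(t in `]0%R, 1%R]) (k t)%:E <= (alpha^-1)%:E)%E.
  rewrite -I01; apply: ge0_le_integral => //=.
  - exact: mk.
  - by apply/measurable_EFinP; exact: measurable_funTS.
  - move=> t; rewrite in_itv/= => /andP[t0 _]; rewrite lee_fin ler_piMr ?powR_ge0//.
    by rewrite -expR0 ler_expR oppr_le0 ltW.
have I01l : ((expR (- 1) / alpha)%:E <=
    \int[lebesgue_measure]_(t in `]0%R, 1%R]) (k t)%:E)%E.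
  rewrite EFinM -I01 -ge0_integralZl_EFin//=.
  - apply: ge0_le_integral => //=.
    + by move=> t _; rewrite -EFinM lee_fin mulr_ge0 ?powR_ge0 ?expR_ge0.
    + apply/measurable_EFinP; apply: measurable_funTS; exact: measurable_funM.
    + exact: mk.
    + move=> t; rewrite in_itv/= => /andP[_ t1]; rewrite -EFinM lee_fin mulrC.
      by rewrite ler_wpM2l ?powR_ge0// ler_expR lerN2.
  - by move=> t _; rewrite lee_fin powR_ge0.
  - by apply/measurable_EFinP; exact: measurable_funTS.
rewrite /Gamma /Rintegral Isplit fine_gt0//; apply/andP; split.
  apply: (@lt_le_trans _ _ (expR (- 1) / alpha)%:E).
    by rewrite lte_fin divr_gt0// expR_gt0.
  apply: le_trans I01l _; rewrite leeDl//; exact: integral_ge0.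
apply: (@le_lt_trans _ _ ((alpha^-1)%:E + 1)%E); first exact: leeD.
by rewrite -EFinD ltry.
Qed.

(** * Affine majorants from concavity *)

Lemma concave_onW (R : realType) (D E : set R) (g : R -> R) :
  D `<=` E -> concave_on E g -> concave_on D g.
Proof.
move=> DE gE t x y; rewrite !inE => xD yD.
by apply: gE; rewrite inE; exact: DE.
Qed.

(** Slopes of a concave function decrease; this is what makes the supremum of
    the slopes to the right of [c] finite in [concave_on_supergradient]. *)
Lemma concave_on_slope (R : realType) (g : R -> R) (a b x c y : R) :
  concave_on `]a, b[ g -> a < x -> x < c -> c < y -> y < b ->
  (g y - g c) / (y - c) <= (g c - g x) / (c - x).
Proof.
move=> gconc ax xc cy yb.
have yx0 : 0 < y - x by lra.
pose t := (y - c) / (y - x).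
have t0 : 0 <= t by rewrite divr_ge0//; lra.
have t1 : t <= 1 by rewrite ler_pdivrMr//; lra.
have xin : x \in `]a, b[%classic by rewrite inE/= in_itv/=; apply/andP; split; lra.
have yin : y \in `]a, b[%classic by rewrite inE/= in_itv/=; apply/andP; split; lra.
have := gconc (Itv01 t0 t1) x y xin yin.
rewrite !convRE/= /conv/= /GRing.scale/= /unstable.onem.
have -> : t * x + (1 - t) * y = c by rewrite /t; field; lra.
rewrite /t => H.
have {}H : (y - c) * g x + (c - x) * g y <= (y - x) * g c.
  have := ler_wpM2l (ltW yx0) H; rewrite mulrDr.
  have -> : (y - x) * ((y - c) / (y - x) * - g x) = - ((y - c) * g x).
    by field; lra.
  have -> : (y - x) * ((1 - (y - c) / (y - x)) * - g y) = - ((c - x) * g y).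
    by field; lra.
  lra.
rewrite ler_pdivrMr ?subr_gt0// mulrAC ler_pdivlMr ?subr_gt0//; lra.
Qed.

(** The supremum of the slopes to the right of [c] serves as supergradient: it
    dominates those slopes, and no slope to the left of [c] is below it. *)
Lemma concave_on_supergradient (R : realType) (g : R -> R) (a b c : R) :
  concave_on `]a, b[ g -> a < c < b ->
  exists s, forall y, a < y < b -> g y <= g c + s * (y - c).
Proof.
move=> gconc /andP[ac cb].
pose S := [set (g y - g c) / (y - c) | y in `]c, b[%classic].
have ubS x : a < x -> x < c -> ubound S ((g c - g x) / (c - x)).
  move=> ax xc _ [y /=+ <-]; rewrite in_itv/= => /andP[cy yb].
  exact: concave_on_slope gconc ax xc cy yb.
have hubS : has_ubound S.
  exists ((g c - g ((a + c) / 2)) / (c - (a + c) / 2)); apply: ubS; lra.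
have S0 : S !=set0.
  exists ((g ((c + b) / 2) - g c) / ((c + b) / 2 - c)), ((c + b) / 2) => //=.
  by rewrite in_itv/=; apply/andP; split; lra.
exists (sup S) => y /andP[ay yb].
have [yc|cy|->] := ltgtP y c; last by rewrite subrr mulr0 addr0.
- have := ge_sup S0 (ubS _ ay yc).
  rewrite ler_pdivlMr ?subr_gt0//; lra.
- have : (g y - g c) / (y - c) <= sup S.
    by apply: ub_le_sup => //; exists y => //=; rewrite in_itv/= cy yb.
  rewrite ler_pdivrMr ?subr_gt0//; lra.
Qed.

(** Concavity of [phi ^ q] passes to an affine majorant of [phi] that is exact
    at [c]. With [K = phi c ^ (q - 1)], Young's inequality gives
    [phi y * K <= phi y ^ q / q + phi c ^ q * (1 - 1/q)], and the supergradient
    bounds [phi y ^ q]; dividing by [K] yields the claim. If [phi c = 0] then a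
    nonnegative concave function vanishing inside vanishes everywhere. *)
Lemma concave_on_powR_supergradient (R : realType) (phi : R -> R) (q a b c : R) :
  1 < q -> (forall x, 0 <= phi x) ->
  concave_on `]a, b[ (fun x => phi x `^ q) -> a < c < b ->
  exists s, forall y, a < y < b -> phi y <= phi c + s * (y - c).
Proof.
move=> q1 phi0 gconc acb; have [sigma Hs] := concave_on_supergradient gconc acb.
have q0 : 0 < q by lra.
move/andP: acb => [ac cb].
have := phi0 c; rewrite le_eqVlt => /predU1P[phic|phic]; last first.
  pose K := phi c `^ (q - 1).
  have K0 : 0 < K by exact: powR_gt0.
  have gc : phi c `^ q = phi c * K by rewrite mulr_powRB1// ltW.
  exists (sigma / (q * K)) => y ayb.
  have p0 : 0 < q / (q - 1) by rewrite divr_gt0//; lra.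
  have conj : q^-1 + (q / (q - 1))^-1 = 1 by field; lra.
  have := conjugate_powR (phi0 y) (ltW K0) q0 p0 conj.
  rewrite /K -powRrM mulrCA divff ?mulr1; last by lra.
  rewrite -/K gc => H.
  have {}H : phi y * K <= phi c * K + sigma * (y - c) / q.
    apply: le_trans H _.
    have -> : phi c * K / (q / (q - 1)) = phi c * K - phi c * K / q by field; lra.
    have := Hs y ayb; rewrite gc => /(ler_wpM2r (_ : 0 <= q^-1)).
    rewrite invr_ge0 ltW// => /(_ isT); lra.
  rewrite -(ler_pM2r K0); apply: le_trans H _.
  by rewrite le_eqVlt; apply/orP; left; apply/eqP; field; lra.
have gc : phi c `^ q = 0 by rewrite -phic powR0// gt_eqF.
(* Testing the supergradient on both sides of c forces a zero slope. *)
have s0 : sigma = 0.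
  have h1 := Hs ((a + c) / 2); have h2 := Hs ((c + b) / 2).
  rewrite gc add0r in h1; rewrite gc add0r in h2.
  have {}h1 : 0 <= sigma * ((a + c) / 2 - c).
    have /h1 : a < (a + c) / 2 < b by apply/andP; split; lra.
    by move=> h; apply: le_trans h; exact: powR_ge0.
  have {}h2 : 0 <= sigma * ((c + b) / 2 - c).
    have /h2 : a < (c + b) / 2 < b by apply/andP; split; lra.
    by move=> h; apply: le_trans h; exact: powR_ge0.
  apply/eqP; rewrite eq_le; apply/andP; split.
    by rewrite nmulr_lge0 in h1 => //; lra.
  by rewrite pmulr_lge0 in h2 => //; lra.
exists 0 => y ayb; have := Hs y ayb.
rewrite gc s0 !mul0r !addr0 -phic => h.
have /powR_eq0_eq0 -> // : phi y `^ q = 0.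
by apply/eqP; rewrite eq_le h powR_ge0.
Qed.

(** * Bounds on increments *)

Lemma absolutely_continuous_within (R : realType) (a b : R) (f : R -> R) :
  absolutely_continuous a b f -> {within `[a, b], continuous f}.
Proof.
move=> fac; apply/subspace_continuousP => x /=; rewrite in_itv/= => /andP[ax xb].
apply/cvgrPdist_lt => e e0; have [d d0 fd] := fac e e0.
have close u v : a <= u -> u <= v -> v <= b -> v - u < d -> `|f v - f u| < e.
  move=> au uv vb vud; have := fd 1%N (fun=> u) (fun=> v); rewrite !big_ord1.
  by apply=> // i j _ _ _; rewrite !ord1.
near=> t.
have : `[a, b]%classic t by near: t; exact: withinT.
rewrite /= in_itv/= => /andP[at_ tb].
have : `|x - t| < d by near: t; apply: cvg_within; exact: nbhsx_ballx.
have [xt|tx] := leP x t.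
  by rewrite distrC ger0_norm ?subr_ge0// => h; rewrite distrC; exact: close.
by rewrite gtr0_norm ?subr_gt0// => h; apply: close => //; exact: ltW.
Unshelve. all: by end_near. Qed.

(** Both [T - f] and [T + f] have nonnegative derivative, hence are monotone. *)
Lemma norm_increment_le (R : realType) (f T : R -> R) (a b : R) :
  {within `[a, b], continuous f} -> {within `[a, b], continuous T} ->
  (forall x, x \in `]a, b[ -> derivable f x 1) ->
  (forall x, x \in `]a, b[ -> derivable T x 1) ->
  (forall x, x \in `]a, b[ -> `|f^`()%classic x| <= T^`()%classic x) ->
  forall u v, a <= u -> u <= v -> v <= b -> `|f v - f u| <= T v - T u.
Proof.
move=> cf cT df dT fT u v au uv vb.
have uin : u \in `[a, b] by rewrite in_itv/= au (le_trans uv vb).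
have vin : v \in `[a, b] by rewrite in_itv/= vb (le_trans au uv).
have hB : T u - f u <= T v - f v.
  apply: (@ger0_derive1_le_cc _ (T - f) a b _ _ _ u v uin vin uv).
  - by move=> x xab; apply: derivableB; [exact: dT|exact: df].
  - move=> x xab; rewrite derive1E deriveB; [|exact: dT|exact: df].
    by have := fT x xab; rewrite !derive1E subr_ge0; apply: le_trans; exact: ler_norm.
  - by move=> x; apply: cvgB; [exact: cT|exact: cf].
have hD : T u + f u <= T v + f v.
  apply: (@ger0_derive1_le_cc _ (T + f) a b _ _ _ u v uin vin uv).
  - by move=> x xab; apply: derivableD; [exact: dT|exact: df].
  - move=> x xab; rewrite derive1E deriveD; [|exact: dT|exact: df].
    have := fT x xab; rewrite !derive1E ler_norml => /andP[+ _]; lra.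
  - by move=> x; apply: cvgD; [exact: cT|exact: cf].
rewrite ler_norml; apply/andP; split; lra.
Qed.

(** The bound is the increment from [u] to [v] of the primitive
    [k x + s (x - c)^2 / 2] of the affine majorant, in factored form. *)
Lemma norm_increment_le_quad (R : realType) (f : R -> R) (a b c k s : R) :
  {within `[a, b], continuous f} ->
  (forall x, x \in `]a, b[ -> derivable f x 1) ->
  (forall x, x \in `]a, b[ -> `|f^`()%classic x| <= k + s * (x - c)) ->
  forall u v, a <= u -> u <= v -> v <= b ->
  `|f v - f u| <= (v - u) * (k + s * ((u + v) / 2 - c)).
Proof.
move=> cf df fk u v au uv vb.
pose T (x : R) := k * x + s / 2 * (x - c) ^+ 2.
have dT (x : R) : is_derive x 1 T (k + s * (x - c)).
  by apply: is_derive_eq; rewrite /GRing.scale/=; field.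
have -> : (v - u) * (k + s * ((u + v) / 2 - c)) = T v - T u.
  by rewrite /T; field.
have cT : continuous T.
  move=> x; have [dx _] := dT x.
  by apply: differentiable_continuous; exact/derivable1_diffP.
apply: (norm_increment_le cf _ df) => //.
- exact: continuous_subspaceT.
- by move=> x xab; rewrite [leRHS]derive1E; have [_ ->] := dT x; exact: fk.
Qed.

(** * Weighted integrals over one half *)

(** The function [u] stands for the distance to one end of an interval of
    length [h], either [y - a] or [b - y]; it enters only through its moments,
    so that both ends are handled at once. The value [e] is that of [f] at the
    opposite end, where [u = h], which is why [e - f y] has the factor
    [h - u y]. As [e h^alpha = alpha * int e u^(alpha-1)], the quantity to bound
    is [alpha * int (e - f) u^(alpha-1)]. *)
Lemma weighted_deviation_le (R : realType) (a b h alpha k s e : R) (u f : R -> R) :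
  0 < h -> 0 < alpha ->
  measurable_fun `[a, b] f -> measurable_fun `[a, b] u ->
  (forall y, `[a, b]%classic y -> 0 <= u y) ->
  (forall beta, 0 < beta ->
    (\int[lebesgue_measure]_(y in `[a, b]) (u y `^ (beta - 1))%:E =
     (h `^ beta / beta)%:E)%E) ->
  (forall y, `[a, b]%classic y ->
    `|e - f y| <= (h - u y) * (k + s * u y)) ->
  `|e * h `^ alpha -
    alpha * \int[lebesgue_measure]_(y in `[a, b]) (f y * u y `^ (alpha - 1))|
  <= k * (h `^ (alpha + 1) / (alpha + 1)) +
     s * (alpha * (h `^ (alpha + 2) / (alpha + 1) - h `^ (alpha + 2) / (alpha + 2))).
Proof.
move=> h0 a0 mf mu u0 mom fe.
pose w beta y := u y `^ (beta - 1).
have mw beta : measurable_fun `[a, b] (w beta).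
  by apply: (measurableT_comp (measurable_powR _)).
have iw beta : 0 < beta -> lebesgue_measure.-integrable `[a, b] (EFin \o w beta).
  move=> b0; apply/integrableP; split; first by apply/measurable_EFinP; exact: mw.
  under eq_integral do rewrite /= ger0_norm ?powR_ge0//.
  by rewrite mom// ltry.
have Rw beta : 0 < beta ->
    \int[lebesgue_measure]_(y in `[a, b]) w beta y = h `^ beta / beta.
  by move=> b0; rewrite /Rintegral mom.
have uw beta y : 0 < beta -> `[a, b]%classic y -> u y * w beta y = w (beta + 1) y.
  by move=> b0 yab; rewrite /w addrK mulr_powRB1// u0.
(* G is the hypothesis on e - f, times the weight, expanded into powers of u. *)
pose G y := k * h * w alpha y + ((s * h - k) * w (alpha + 1) y - s * w (alpha + 2) y).
have GE y : `[a, b]%classic y -> G y = (h - u y) * (k + s * u y) * w alpha y.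
  move=> yab; rewrite /G (_ : alpha + 2 = alpha + 1 + 1); last by rewrite -addrA.
  by rewrite -!uw//; [ring|lra].
have a10 : 0 < alpha + 1 by lra.
have a20 : 0 < alpha + 2 by lra.
have mI := @measurable_itv R `[a, b].
have iZ r beta : 0 < beta ->
    lebesgue_measure.-integrable `[a, b] (EFin \o (fun y => r * w beta y)).
  by move=> b0; exact: (@integrableZl _ _ R (@lebesgue_measure R) _ mI r _ (iw _ b0)).
have iB : lebesgue_measure.-integrable `[a, b]
    (EFin \o (fun y => (s * h - k) * w (alpha + 1) y - s * w (alpha + 2) y)).
  exact: (@integrableB _ _ R (@lebesgue_measure R) _ mI _ _
    (iZ _ _ a10) (iZ _ _ a20)).
have iG : lebesgue_measure.-integrable `[a, b] (EFin \o G).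
  exact: (@integrableD _ _ R (@lebesgue_measure R) _ mI _ _ (iZ _ _ a0) iB).
have dE y : `[a, b]%classic y -> `|(e - f y) * w alpha y| <= G y.
  move=> yab; rewrite normrM (ger0_norm (powR_ge0 _ _)) GE//.
  by rewrite ler_wpM2r ?powR_ge0// fe.
have id : lebesgue_measure.-integrable `[a, b] (EFin \o (fun y => (e - f y) * w alpha y)).
  apply: le_integrable iG => //.
    apply/measurable_EFinP; apply: measurable_funM; last exact: mw.
    by apply: measurable_funB => //; exact: measurable_cst.
  by move=> y yab; rewrite lee_fin; exact: le_trans (dE y yab) (ler_norm _).
have -> : e * h `^ alpha -
    alpha * \int[lebesgue_measure]_(y in `[a, b]) (f y * u y `^ (alpha - 1)) =
    alpha * \int[lebesgue_measure]_(y in `[a, b]) ((e - f y) * w alpha y).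
  have -> : \int[lebesgue_measure]_(y in `[a, b]) (f y * u y `^ (alpha - 1)) =
      \int[lebesgue_measure]_(y in `[a, b]) (e * w alpha y - (e - f y) * w alpha y).
    by apply: eq_Rintegral => y _; rewrite /w; ring.
  rewrite (@RintegralB _ _ R (@lebesgue_measure R) _ _ _ mI (iZ _ _ a0) id).
  rewrite RintegralZl//; last exact: iw.
  by rewrite Rw//; field; lra.
rewrite normrM gtr0_norm//.
have le1 : `|\int[lebesgue_measure]_(y in `[a, b]) ((e - f y) * w alpha y)| <=
    \int[lebesgue_measure]_(y in `[a, b]) G y.
  apply: le_trans (@le_normr_Rintegral _ _ R (@lebesgue_measure R) _ _ mI id) _.
  apply: le_Rintegral => //; exact: integrable_norm.
apply: le_trans (ler_wpM2l (ltW a0) le1) _.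
rewrite (@RintegralD _ _ R (@lebesgue_measure R) _ _ _ mI (iZ _ _ a0) iB).
rewrite (@RintegralB _ _ R (@lebesgue_measure R) _ _ _ mI
  (iZ _ _ a10) (iZ _ _ a20)).
rewrite !RintegralZl//; [|exact: iw..].
rewrite !Rw//.
have h1 : h `^ (alpha + 1) = h * h `^ alpha.
  by rewrite -(@mulr_powRB1 _ h (alpha + 1)) ?addrK// ltW.
have h2 : h `^ (alpha + 2) = h * (h * h `^ alpha).
  by rewrite -h1 -(@mulr_powRB1 _ h (alpha + 2)) ?ltW//; congr (_ * _ `^ _); ring.
rewrite h1 h2 le_eqVlt; apply/orP; left; apply/eqP; field; lra.
Qed.

(** Two instances of [weighted_deviation_le], with [u = y - a], [e = f b] and
    with [u = b - y], [e = f a]. Measured from the midpoint, the slope [s]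
    appears as [s / 2] in the first and as [- s / 2] in the second, and
    disappears from the sum. *)
Lemma fractional_trapezoid_le (R : realType) (f : R -> R) (a b alpha q : R) :
  a < b -> 0 < alpha -> 1 < q ->
  {within `[a, b], continuous f} ->
  (forall x, x \in `]a, b[ -> derivable f x 1) ->
  concave_on `]a, b[ (fun x => `|f^`()%classic x| `^ q) ->
  `|(f a + f b) * (b - a) `^ alpha - alpha *
     (\int[lebesgue_measure]_(y in `[a, b]) (f y * (y - a) `^ (alpha - 1)) +
      \int[lebesgue_measure]_(y in `[a, b]) (f y * (b - y) `^ (alpha - 1)))|
  <= 2 * `|f^`()%classic ((a + b) / 2)| * ((b - a) `^ (alpha + 1) / (alpha + 1)).
Proof.
move=> ab a0 q1 cf df fconc; set c := (a + b) / 2.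
have acb : a < c < b by apply/andP; rewrite /c; split; lra.
have [s Hs] := concave_on_powR_supergradient q1
  (fun x => normr_ge0 (f^`()%classic x)) fconc acb.
set k := `|f^`()%classic c| in Hs *.
have h0 : 0 < b - a by rewrite subr_gt0.
have fincr : forall u v, a <= u -> u <= v -> v <= b ->
    `|f v - f u| <= (v - u) * (k + s * ((u + v) / 2 - c)).
  apply: (norm_increment_le_quad cf df) => x; rewrite in_itv/=; exact: Hs.
have mf : measurable_fun `[a, b] f.
  by apply: subspace_continuous_measurable_fun => //; exact: measurable_itv.
have Hb : `|f b * (b - a) `^ alpha - alpha *
    \int[lebesgue_measure]_(y in `[a, b]) (f y * (y - a) `^ (alpha - 1))| <=
    k * ((b - a) `^ (alpha + 1) / (alpha + 1)) + s / 2 *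
    (alpha * ((b - a) `^ (alpha + 2) / (alpha + 1) -
              (b - a) `^ (alpha + 2) / (alpha + 2))).
  apply: (@weighted_deviation_le _ a b (b - a) alpha k (s / 2) (f b)
    (fun y => y - a)) => //.
  - by apply: measurable_funB => //; exact: measurable_cst.
  - by move=> y /=; rewrite in_itv/= => /andP[ay _]; rewrite subr_ge0.
  - by move=> beta; exact: integral_powR_subl.
  - move=> y /=; rewrite in_itv/= => /andP[ay yb].
    apply: le_trans (fincr _ _ ay yb (lexx b)) _.
    by rewrite le_eqVlt; apply/orP; left; apply/eqP; rewrite /c; field.
have Ha : `|f a * (b - a) `^ alpha - alpha *
    \int[lebesgue_measure]_(y in `[a, b]) (f y * (b - y) `^ (alpha - 1))| <=
    k * ((b - a) `^ (alpha + 1) / (alpha + 1)) + - (s / 2) *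
    (alpha * ((b - a) `^ (alpha + 2) / (alpha + 1) -
              (b - a) `^ (alpha + 2) / (alpha + 2))).
  apply: (@weighted_deviation_le _ a b (b - a) alpha k (- (s / 2)) (f a)
    (fun y => b - y)) => //.
  - by apply: measurable_funB => //; exact: measurable_cst.
  - by move=> y /=; rewrite in_itv/= => /andP[_ yb]; rewrite subr_ge0.
  - by move=> beta; exact: integral_powR_subr.
  - move=> y /=; rewrite in_itv/= => /andP[ay yb].
    rewrite distrC; apply: le_trans (fincr _ _ (lexx a) ay yb) _.
    by rewrite le_eqVlt; apply/orP; left; apply/eqP; rewrite /c; field.
have a10 : alpha + 1 != 0 by rewrite gt_eqF// addr_gt0.
have a20 : alpha + 2 != 0 by rewrite gt_eqF// addr_gt0.
clear fincr mf.
move: Hb Ha; move: (Rintegral _ _ _) => Ib Hb; move: (Rintegral _ _ _) => Ia Ha.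
have -> : (f a + f b) * (b - a) `^ alpha - alpha * (Ib + Ia) =
    (f b * (b - a) `^ alpha - alpha * Ib) + (f a * (b - a) `^ alpha - alpha * Ia).
  by ring.
apply: le_trans (ler_normD _ _) _.
apply: le_trans (lerD Hb Ha) _.
by rewrite le_eqVlt; apply/orP; left; apply/eqP; field; rewrite a10 a20.
Qed.

(** * The midpoint-trapezoid inequality *)

(** Bernoulli's inequality [1 + alpha p <= (1 + alpha)^p], obtained from Young's
    inequality for the product of the root with 1. *)
Lemma powR_root_le (R : realType) (alpha p q : R) :
  0 < alpha -> 0 < p -> 0 < q -> p^-1 + q^-1 = 1 ->
  (alpha * p + 1) `^ p^-1 <= alpha + 1.
Proof.
move=> a0 p0 q0 pq.
have ap0 : 0 < alpha * p + 1 by rewrite addr_gt0// mulr_gt0.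
have := conjugate_powR (powR_ge0 (alpha * p + 1) p^-1) ler01 p0 q0 pq.
rewrite mulr1 powR1 /= -powRrM mulVf ?gt_eqF// powRr1 ?(ltW ap0)// => h.
apply: le_trans h _.
have -> : (alpha * p + 1) / p + 1 / q = alpha + (p^-1 + q^-1).
  by field; rewrite !gt_eqF.
by rewrite pq.
Qed.

Theorem theorem2p6 (R : realType) (theta1 theta2 alpha p q : R)
    (B f : R -> R)
    (htheta : theta1 < theta2)
    (halpha : 0 < alpha <= 1)
    (hB : 0 < B alpha)
    (hq : 1 < q)
    (hpq : p^-1 + q^-1 = 1)
    (hdiff : forall x : R, theta1 < x < theta2 -> derivable f x 1)
    (hH1 : H1 theta1 theta2 f)
    (hL1 : L1_on theta1 theta2 f^`()%classic)
    (hconc : concave_on `]theta1, theta2[%classic (fun x => `|f^`()%classic x| `^ q)) :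
  `| (2 * (theta2 - theta1) `^ alpha +
        (1 - alpha) * 2 `^ (alpha + 1) * Gamma alpha) /
       (theta2 - theta1) `^ (alpha + 1) *
       (f theta1 + f theta2 + 2 * f ((theta1 + theta2) / 2))
     - (2 `^ (alpha + 1) * B alpha * Gamma alpha) /
       (theta2 - theta1) `^ (alpha + 1) *
       (AB_right B ((theta1 + theta2) / 2) alpha f theta1 +
        AB_left B theta1 alpha f ((theta1 + theta2) / 2) +
        AB_left B ((theta1 + theta2) / 2) alpha f theta2 +
        AB_right B theta2 alpha f ((theta1 + theta2) / 2)) |
  <= 2 / (alpha * p + 1) `^ p^-1 *
     (`|f^`()%classic ((3 * theta1 + theta2) / 4)| +
      `|f^`()%classic ((3 * theta2 + theta1) / 4)|).
Proof.
have [a0 a1] := andP halpha; have G0 := Gamma_gt0 halpha.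
have cf : {within `[theta1, theta2], continuous f}.
  exact: absolutely_continuous_within hH1.1.
set m := (theta1 + theta2) / 2.
have m1 : theta1 < m by rewrite /m; lra.
have m2 : m < theta2 by rewrite /m; lra.
pose h := m - theta1.
have h0 : 0 < h by rewrite subr_gt0.
have hE : theta2 - m = h by rewrite /h /m; field.
have LE : theta2 - theta1 = 2 * h by rewrite /h /m; field.
have half a b : theta1 <= a -> a < b -> b <= theta2 ->
    `|(f a + f b) * (b - a) `^ alpha - alpha *
     (\int[lebesgue_measure]_(y in `[a, b]) (f y * (y - a) `^ (alpha - 1)) +
      \int[lebesgue_measure]_(y in `[a, b]) (f y * (b - y) `^ (alpha - 1)))|
    <= 2 * `|f^`()%classic ((a + b) / 2)| * ((b - a) `^ (alpha + 1) / (alpha + 1)).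
  move=> ha ab hb; apply: (fractional_trapezoid_le ab a0 hq).
  - by apply: continuous_subspaceW cf; apply: subset_itv; rewrite bnd_simp.
  - move=> x; rewrite in_itv/= => /andP[ax xb]; apply: hdiff.
    by rewrite (le_lt_trans ha ax) (lt_le_trans xb hb).
  - by apply: concave_onW hconc; apply: subset_itv; rewrite bnd_simp.
have := half m theta2 (ltW m1) m2 (lexx _).
have := half theta1 m (lexx _) m1 (ltW m2).
rewrite /AB_left /AB_right.
rewrite (_ : (theta1 + m) / 2 = (3 * theta1 + theta2) / 4); last by rewrite /m; field.
rewrite (_ : (m + theta2) / 2 = (3 * theta2 + theta1) / 4); last by rewrite /m; field.
rewrite LE hE -/h.
set I1 := Rintegral _ _ _; set I2 := Rintegral _ _ _.
set I4 := Rintegral _ _ _; set I3 := Rintegral _ _ _.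
set F1 := `|_ ((3 * theta1 + theta2) / 4)|.
set F2 := `|_ ((3 * theta2 + theta1) / 4)|.
have pow1 x : 0 < x -> x `^ (alpha + 1) = x * x `^ alpha :> R.
  by move=> x0; rewrite -(@mulr_powRB1 _ x (alpha + 1)) ?addrK ?ltW// addr_gt0.
rewrite !pow1 ?mulr_gt0//.
rewrite powRM ?(ltW h0)//.
have H0 : 0 < h `^ alpha by exact: powR_gt0.
have P0 : 0 < 2 `^ alpha :> R by exact: powR_gt0.
set H := h `^ alpha in H0 *; set P := 2 `^ alpha in P0 *.
move=> le1 le2.
have hH0 : 0 < h * H by exact: mulr_gt0.
(* The terms with 1 - alpha cancel, as do B alpha and Gamma alpha. *)
rewrite (_ : _ - _ = (((f theta1 + f m) * H - alpha * (I1 + I2)) +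
  ((f m + f theta2) * H - alpha * (I4 + I3))) / (h * H)); last first.
  by field; rewrite ?gt_eqF.
rewrite normrM [X in _ * X]gtr0_norm ?invr_gt0// ler_pdivrMr//.
apply: le_trans (ler_normD _ _) _.
apply: le_trans (lerD le1 le2) _.
have q0 : 0 < q by exact: lt_trans ltr01 hq.
have p0 : 0 < p.
  by rewrite -invr_gt0 (_ : p^-1 = 1 - q^-1) ?subr_gt0 ?invf_lt1// -hpq addrK.
have K1 := powR_root_le a0 p0 q0 hpq.
have K0 : 0 < (alpha * p + 1) `^ p^-1.
  by rewrite powR_gt0// addr_gt0// mulr_gt0.
rewrite (_ : _ + _ = 2 / (alpha + 1) * (F1 + F2) * (h * H)); last first.
  by field; rewrite gt_eqF// addr_gt0.
rewrite ler_wpM2r ?(ltW hH0)// ler_wpM2r ?addr_ge0 ?normr_ge0//.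
by rewrite ler_wpM2l// lef_pV2 ?posrE// addr_gt0.
Qed.
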